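(* For all integers $p,q>1$, \begin{align*} (1-(-1)^{p+q})T_{p,q}=&(-1)^{p+q}\widetilde{t}(p+q)-(-1)^p(1+(-1)^q)\widetilde{t}(p)\widetilde{t}(q)\\ &-(-1)^{p}\sum_{k=0}^{p-1}((-1)^k-1)\binom{p+q-k-2}{q-1} \widetilde{t}(k+1) \zeta(p+q-k-1)\\ &+2(-1)^p\sum_{\substack{2k_1+k_2=q+1\\ k_1,k_2\geq 1}} \binom{k_2+p-2}{p-1} \widetilde{t}(2k_1)\zeta(k_2+p-1). \end{align*}
   Context: For $n\in\mathbb{N}_0$ and $p\in\mathbb{N}$ let $h_n^{(p)}=\sum_{k=1}^n (k-1/2)^{-p}$ (so $h_0^{(p)}=0$). For positive integers $p$ and $q\ge 2$, the Euler $T$-sum is $T_{p,q}=\sum_{n=1}^\infty \frac{h_{n-1}^{(p)}}{(n-1/2)^q}$. For integers $s>1$, $\widetilde{t}(s)=\sum_{n=1}^\infty (n-1/2)^{-s}=(2^s-1)\zeta(s)$; $\zeta$ is the Riemann zeta function. (Terms with $\widetilde t(1)$ occur only with coefficient $(-1)^0-1=0$.) *)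

(* Defs.v *)
From mathcomp Require Import all_boot all_order all_algebra.
From mathcomp Require Import all_classical all_reals all_analysis.

Set Implicit Arguments.
Unset Strict Implicit.
Unset Printing Implicit Defensive.

Import Order.TTheory GRing.Theory Num.Theory.
Import numFieldNormedType.Exports.

Local Open Scope ring_scope.
Local Open Scope classical_set_scope.

Section EulerTSums.
Variable R : realType.

Definition hsum (p n : nat) : R :=
  \sum_(1 <= k < n.+1) (k%:R - 2^-1) ^- p.

(* The infinite sums below are limits in R of the partial sums; such a limit
   is meaningful only for a convergent series. In particular zeta 1 and
   ttilde 1 are junk values. *)
Definition zeta (s : nat) : R :=
  limn (fun N => \sum_(1 <= n < N) (n%:R : R) ^- s).

Definition ttilde (s : nat) : R :=
  limn (fun N => \sum_(1 <= n < N) (n%:R - 2^-1 : R) ^- s).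

Definition Tsum (p q : nat) : R :=
  limn (fun N => \sum_(1 <= n < N) hsum p n.-1 / (n%:R - 2^-1) ^+ q).

End EulerTSums.

Arguments hsum : clear implicits.
Arguments zeta : clear implicits.
Arguments ttilde : clear implicits.
Arguments Tsum : clear implicits.

(* Main.v *)
(** Sum [1 / (a^p b^q)] over all pairs [a < b] of half-odd integers in
    [(-N, N)], in two ways.  Splitting by the signs of [a] and [b] gives the
    truncations of [T_{p,q} + (-1)^{p+q} T_{q,p} + (-1)^p t(p) t(q)], and
    [T_{q,p}] is eliminated by [t(p) t(q) = T_{p,q} + T_{q,p} + t(p+q)].
    Expanding [1 / (a^p b^q)] in partial fractions with [m = b - a], each term
    factors, up to the truncation, into [sum_m 1/m^r] with [r >= 2] and a
    bilateral sum [sum_a 1/a^k], which vanishes for odd [k] and tends to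
    [2 t(k)] for even [k].  The truncation error is bounded through
    [zeta(r) - sum_{m <= n} 1/m^r <= 1/(n + 1/2)] by a constant times the mean
    of [1/a] over the positive half-odd [a < N], hence tends to [0]. *)

Require Import Defs.
From mathcomp Require Import all_boot all_order all_algebra.
From mathcomp Require Import all_classical all_reals all_analysis.
From mathcomp Require Import ring lra zify.

Import Order.TTheory GRing.Theory Num.Theory.
Import numFieldNormedType.Exports.

Local Open Scope ring_scope.

(** * Partial fractions over a commutative ring *)

(** Pascal's rule carries the [X]-half of the expansion from exponents [(p+1, q)] and [(p, q+1)] to
    [(p+1, q+1)]. The sign [s] is [-1] for that half and [1] for the [Y]-half, where [p] and [q]
    trade places. *)
Lemma partial_fractions_step (R : comPzRingType) (s X Z : R) (p q : nat) :
  \sum_(k < p.+1) s ^+ k * 'C(q + k, k)%:R * X ^+ (p.+1 - k) * Z ^+ (q.+1 + k) =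
  Z * (\sum_(k < p.+1) s ^+ k * 'C((q + k).-1, k)%:R
                         * X ^+ (p.+1 - k) * Z ^+ (q + k)
       + s * \sum_(k < p) s ^+ k * 'C(q + k, k)%:R
                         * X ^+ (p - k) * Z ^+ (q.+1 + k)).
Proof.
rewrite big_ord_recl [in RHS]big_ord_recl /= !addn0 !bin0 !expr0 !subn0.
rewrite -addrA mulr_sumr -big_split mulrDr mulr_sumr; congr (_ + _).
  by rewrite !exprS; ring.
apply: eq_bigr => i _; rewrite /bump /= add1n subSS !addSn !addnS /= binS natrD !exprS.
by ring.
Qed.

(* [X = 1/x], [Y = 1/(x + m)] and [Z = 1/m] satisfy [X * Y = Z * (X - Y)]. *)
Lemma partial_fractions (R : comPzRingType) (X Y Z : R) (p q : nat) :
  X * Y = Z * (X - Y) -> (0 < p + q)%N ->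
  X ^+ p * Y ^+ q =
    \sum_(k < p) (-1) ^+ k * 'C((q + k).-1, k)%:R * X ^+ (p - k) * Z ^+ (q + k)
    + (-1) ^+ p *
      \sum_(l < q) 'C((p + l).-1, l)%:R * Y ^+ (q - l) * Z ^+ (p + l).
Proof.
move=> XY.
(* When one exponent is 0, the truncated predecessor gives ['C(k.-1, k)], which is 1 at [k = 0] and
   0 beyond, so a single term survives. *)
have base (W : R) (c : nat -> R) n : c 0 = 1 -> W ^+ n.+1 =
    \sum_(k < n.+1) c k * 'C((0 + k).-1, k)%:R * W ^+ (n.+1 - k) * Z ^+ (0 + k).
  move=> c0; rewrite big_ord_recl big1 /= => [|i _].
    by rewrite c0 bin0 subn0 expr0; ring.
  by rewrite add0n bin_small ?mulr0 ?mul0r.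
elim: p q => [|p IHp] q.
  case: q => [//|q _]; rewrite big_ord0 add0r expr0 !mul1r.
  rewrite (base Y (fun=> 1)) //.
  by apply: eq_bigr => i _; rewrite mul1r.
elim: q => [_|q IHq _].
  rewrite big_ord0 mulr0 addr0 mulr1.
  exact: (base X (fun k => (-1) ^+ k)).
have -> : X ^+ p.+1 * Y ^+ q.+1 = Z * (X ^+ p.+1 * Y ^+ q - X ^+ p * Y ^+ q.+1).
  by rewrite !exprS mulrACA XY; ring.
rewrite IHq ?addSn // IHp ?addnS //.
under [X in _ = X + _]eq_bigr => k _ do rewrite addSn /=.
under [X in _ = _ + _ * X]eq_bigr => k _ do rewrite addSn /=.
under [X in Z * (_ - (X + _))]eq_bigr => k _ do rewrite addSn /=.
under [X in Z * (_ + _ * X - _)]eq_bigr => k _ do rewrite addSn /=.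
rewrite partial_fractions_step.
have := partial_fractions_step R 1 Y Z q p.
under [X in X = _]eq_bigr => l _ do rewrite expr1n mul1r.
under [X in _ * (X + _)]eq_bigr => l _ do rewrite expr1n mul1r.
under [X in _ * (_ + _ * X)]eq_bigr => l _ do rewrite expr1n mul1r.
move=> ->; rewrite exprS; ring.
Qed.

(** * Sums over ordered pairs of indices *)

(** Reflecting the indices reverses their order, so [i < j] becomes [n-1-j < n-1-i]. *)
Lemma sum_pairs_rev (R : nmodType) (n : nat) (F : nat -> nat -> R) :
  \sum_(j < n) \sum_(i < j) F i j =
  \sum_(j < n) \sum_(i < j) F (n - j.+1)%N (n - i.+1)%N.
Proof.
have E G : \sum_(j < n) \sum_(i < j) G (i : nat) (j : nat) =
           \sum_(j < n) \sum_(i < n | (i < j)%N) G i j :> R.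
  by apply: eq_bigr => j _; rewrite (big_ord_widen n (G^~ (j : nat))) // ltnW.
rewrite E (E (fun i j => F (n - j.+1)%N (n - i.+1)%N)).
rewrite (exchange_big_dep xpredT) //= (reindex_inj rev_ord_inj) /=.
apply: eq_bigr => j _; rewrite (reindex_inj rev_ord_inj) /=.
by apply: eq_bigl => i; have := ltn_ord i; have := ltn_ord j; lia.
Qed.

(** The square of index pairs splits into two triangles and the diagonal. *)
Lemma sum_pairs_mul (R : comPzRingType) (n : nat) (f g : nat -> R) :
  (\sum_(i < n) f i) * (\sum_(i < n) g i) =
  \sum_(j < n) \sum_(i < j) f i * g j + \sum_(j < n) \sum_(i < j) g i * f j
  + \sum_(i < n) f i * g i.
Proof.
elim: n => [|n IHn]; first by rewrite !big_ord0 mul0r !addr0.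
rewrite !big_ord_recr /= -mulr_suml -[X in _ + (_ + X) + _]mulr_suml.
rewrite mulrDl !mulrDr IHn; ring.
Qed.

(** * Truncated series, their tails and their convergence *)

Section TruncatedSums.
Local Open Scope classical_set_scope.
Variable R : realType.
Implicit Types (p q s r k n N : nat).

Local Notation half n := (n%:R + 2^-1 : R).

Definition zeta_part s N : R := \sum_(m < N) m.+1%:R ^- s.

Definition ttilde_part s N : R := \sum_(i < N) half i ^- s.

Definition Tsum_part p q N : R :=
  \sum_(j < N) \sum_(i < j) half i ^- p * half j ^- q.

Lemma half_gt0 n : 0 < half n.
Proof. by rewrite ltr_wpDl ?ler0n ?invr_gt0 ?ltr0n. Qed.

Lemma half_succ n : n.+1%:R - 2^-1 = half n.
Proof. by rewrite -natr1; lra. Qed.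

Lemma zeta_term_ge0 s m : 0 <= m.+1%:R ^- s :> R.
Proof. by rewrite invr_ge0 exprn_ge0. Qed.

Lemma half_exp_ge0 s i : 0 <= half i ^- s.
Proof. by rewrite invr_ge0 exprn_ge0 // ltW ?half_gt0. Qed.

Lemma sum_ord_nondecreasing (f : nat -> R) : (forall i, 0 <= f i) ->
  {homo (fun N => \sum_(i < N) f i) : n m / (n <= m)%N >-> n <= m}.
Proof.
move=> f0 n m nm; rewrite -[m](subnKC nm) big_split_ord /= lerDl.
by apply: sumr_ge0 => i _; exact: f0.
Qed.

Lemma sum_ord_cvg (f : nat -> R) (B : R) : (forall i, 0 <= f i) ->
  (forall N, \sum_(i < N) f i <= B) ->
  cvgn (fun N => \sum_(i < N) f i).
Proof.
move=> f0 fB; apply: nondecreasing_is_cvgn; first exact: sum_ord_nondecreasing.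
by exists B => _ [N _ <-]; exact: fB.
Qed.

(** The defining partial sums stop before [N], so they lag by one term, which leaves the limit
    unchanged. *)
Lemma sum_from1_cvg (f : nat -> R) : cvgn (fun N => \sum_(i < N) f i.+1) ->
  (fun N => \sum_(i < N) f i.+1) @ \oo -->
    limn (fun N => \sum_(1 <= n < N) f n).
Proof.
move=> cf.
have E : (fun N => \sum_(i < N) f i.+1) = (fun N => \sum_(1 <= n < N.+1) f n).
  by apply/funext => N; rewrite big_add1 big_mkord.
suff -> : limn (fun N => \sum_(1 <= n < N) f n) =
          limn (fun N => \sum_(i < N) f i.+1) by [].
apply: cvg_lim => //.
by rewrite -cvg_shiftS /= -E.
Qed.

(** Telescoping: for [a >= 1], [1/a^s <= 1/a^2 <= 1/(a^2 - 1/4) = 1/(a - 1/2) - 1/(a + 1/2)]. *)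
Lemma zeta_part_tail s n d : (1 < s)%N ->
  zeta_part s (n + d) - zeta_part s n <= (half n)^-1.
Proof.
move=> s1.
suff H : zeta_part s (n + d) - zeta_part s n <= (half n)^-1 - (half (n + d))^-1.
  by apply: le_trans H _; rewrite gerBl invr_ge0 ltW ?half_gt0.
elim: d => [|d IHd]; first by rewrite addn0 !subrr.
rewrite addnS /zeta_part big_ord_recr /= -/(zeta_part s (n + d)).
have : (n + d).+1%:R ^- s <= (half (n + d))^-1 - (half (n + d).+1)^-1.
  have a1 : 1 <= (n + d).+1%:R :> R by rewrite ler1n.
  apply: (@le_trans _ _ ((n + d).+1%:R ^- 2)).
    rewrite lef_pV2 ?posrE ?exprn_gt0 ?ltr0n //.
    exact: ler_weXn2l.
  have -> : half (n + d) = (n + d).+1%:R - 2^-1 by rewrite half_succ.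
  move: a1; set a := (n + d).+1%:R => a1.
  have a2 : 0 < a - 2^-1 by lra.
  have a3 : 0 < a + 2^-1 by lra.
  have -> : (a - 2^-1)^-1 - (a + 2^-1)^-1 = ((a - 2^-1) * (a + 2^-1))^-1.
    by field; rewrite !gt_eqF //; lra.
  have a0 : 0 < a by lra.
  rewrite lef_pV2 ?posrE ?mulr_gt0 ?exprn_gt0 //.
  by nra.
move=> H; rewrite addrAC; apply: le_trans (lerD IHd H) _.
by rewrite addrA subrK.
Qed.

Lemma zeta_part_cvg s : (1 < s)%N -> zeta_part s @ \oo --> zeta R s.
Proof.
move=> s1; apply: (@sum_from1_cvg (fun n => n%:R ^- s)).
(* The bound 2 is [(half 0)^-1], the tail estimate from [n = 0]. *)
apply: (@sum_ord_cvg (fun i => i.+1%:R ^- s) 2) => [i|N]; first exact: zeta_term_ge0.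
have := @zeta_part_tail s 0 N s1.
by rewrite add0n {2}/zeta_part big_ord0 subr0 add0r invrK.
Qed.

Lemma zeta_tail_ge0 s n : (1 < s)%N -> 0 <= zeta R s - zeta_part s n.
Proof.
move=> /zeta_part_cvg c; rewrite subr_ge0.
rewrite -(cvg_lim (@Rhausdorff R) c).
apply: nondecreasing_cvgn_le; last by apply/cvg_ex; exists (zeta R s).
exact: (@sum_ord_nondecreasing (fun m => m.+1%:R ^- s) (zeta_term_ge0 s)).
Qed.

Lemma zeta_tail_le s n : (1 < s)%N -> zeta R s - zeta_part s n <= (half n)^-1.
Proof.
move=> s1; have c := zeta_part_cvg _ s1.
rewrite lerBlDr -(cvg_lim (@Rhausdorff R) c).
apply: limr_le; first by apply/cvg_ex; exists (zeta R s).
exists n => //= m /= nm; rewrite -lerBlDr -(subnKC nm); exact: zeta_part_tail.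
Qed.

Lemma ttilde_part_cvg s : (1 < s)%N -> ttilde_part s @ \oo --> ttilde R s.
Proof.
move=> s1.
have E : ttilde_part s = fun N => \sum_(i < N) (i.+1%:R - 2^-1) ^- s.
  by apply/funext => N; apply: eq_bigr => i _; rewrite half_succ.
rewrite E; apply: (@sum_from1_cvg (fun n => (n%:R - 2^-1) ^- s)); rewrite -E.
(* The bound comes from [half i >= (i+1)/2], applied term by term. *)
apply: (@sum_ord_cvg (fun i => half i ^- s) (2 ^+ s * zeta R s)) => [i|N]; first exact: half_exp_ge0.
apply: (@le_trans _ _ (2 ^+ s * zeta_part s N)); last first.
  by rewrite ler_pM2l ?exprn_gt0 // -subr_ge0 zeta_tail_ge0.
rewrite mulr_sumr; apply: ler_sum => i _.
have -> : 2 ^+ s * i.+1%:R ^- s = (i.+1%:R / 2) ^- s :> R.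
  by rewrite -!exprVn -exprMn invf_div.
rewrite lef_pV2 ?posrE ?exprn_gt0 ?divr_gt0 ?half_gt0 ?ltr0n //.
rewrite lerXn2r ?nnegrE ?divr_ge0 ?(ltW (half_gt0 _)) //.
by rewrite -natr1; have := ler0n R i; lra.
Qed.

Lemma ttilde_part_le s N : (1 < s)%N -> ttilde_part s N <= ttilde R s.
Proof.
move=> /ttilde_part_cvg c; rewrite -(cvg_lim (@Rhausdorff R) c).
apply: nondecreasing_cvgn_le; last by apply/cvg_ex; exists (ttilde R s).
exact: (@sum_ord_nondecreasing (fun i => half i ^- s) (half_exp_ge0 s)).
Qed.

Lemma ttilde_part_ge0 s N : 0 <= ttilde_part s N.
Proof. by apply: sumr_ge0 => i _; exact: half_exp_ge0. Qed.

Lemma ttilde_part_mul p q N : ttilde_part p N * ttilde_part q N =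
  Tsum_part p q N + Tsum_part q p N + ttilde_part (p + q) N.
Proof.
rewrite /ttilde_part (sum_pairs_mul _ _ (fun i => half i ^- p) (fun i => half i ^- q)).
congr (_ + _); apply: eq_bigr => i _; by rewrite exprD invfM.
Qed.

Lemma Tsum_part_cvg p q : (1 < p)%N -> (1 < q)%N ->
  Tsum_part p q @ \oo --> Tsum R p q.
Proof.
move=> p1 q1.
have E : Tsum_part p q =
    fun N => \sum_(i < N) hsum R p i / (i.+1%:R - 2^-1) ^+ q.
  apply/funext => N; apply: eq_bigr => j _; rewrite half_succ mulr_suml.
  rewrite /hsum big_add1 /= big_mkord.
  by apply: eq_bigr => i _; rewrite half_succ.
have T0 p' q' N : 0 <= Tsum_part p' q' N.
  by do 2![apply: sumr_ge0 => ? _]; rewrite mulr_ge0 ?half_exp_ge0.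
rewrite E; apply: (@sum_from1_cvg (fun n => hsum R p n.-1 / (n%:R - 2^-1) ^+ q)).
rewrite -E.
(* This double sum is one of three nonnegative pieces of the product of the truncations of [t(p)]
   and [t(q)]. *)
apply: (@sum_ord_cvg (fun j => \sum_(i < j) half i ^- p * half j ^- q) (ttilde R p * ttilde R q)) => [j|N].
  by apply: sumr_ge0 => i _; rewrite mulr_ge0 ?half_exp_ge0.
apply: (@le_trans _ _ (ttilde_part p N * ttilde_part q N)); last first.
  by rewrite ler_pM ?ttilde_part_ge0 ?ttilde_part_le.
rewrite ttilde_part_mul -/(Tsum_part p q N).
by have := T0 q p N; have := ttilde_part_ge0 (p + q) N; lra.
Qed.

(** The terms tend to 0, hence so do their Cesaro means. *)
Lemma inv_half_mean_cvg0 :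
  (fun N => (\sum_(i < N) (half i)^-1) / N%:R) @ \oo --> (0 : R).
Proof.
have h0 : (fun i => (half i)^-1) @ \oo --> (0 : R).
  apply: (@squeeze_cvgr _ _ _ _ (fun=> 0) (fun i => 2 * harmonic i)).
  - exists 0%N => //= i _; rewrite invr_ge0 ltW ?half_gt0 //=.
    have -> : 2 * i.+1%:R^-1 = (i.+1%:R / 2)^-1 :> R by rewrite invf_div.
    rewrite lef_pV2 ?posrE ?divr_gt0 ?half_gt0 ?ltr0n //.
    by rewrite -natr1; have := ler0n R i; lra.
  - exact: cvg_cst.
  - by rewrite -[X in _ --> X](mulr0 2); apply: cvgMl_tmp; exact: cvg_harmonic.
rewrite -cvg_shiftS /=.
suff -> : (fun N => (\sum_(i < N.+1) (half i)^-1) / N.+1%:R) =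
  arithmetic_mean (fun i => (half i)^-1) by exact: cesaro.
apply/funext => N; rewrite /arithmetic_mean /series /= big_mkord.
by rewrite mulrC.
Qed.

(** * The symmetric window of half-odd integers and its truncation error *)

(** For [i] in [[0, 2N)] this lists the half-odd integers of [(-N, N)] in increasing order, so
    differences of values are differences of indices. *)
Definition centered N i : R := half i - N%:R.

Lemma centered_right N i : centered N (N + i) = half i.
Proof. by rewrite /centered natrD; lra. Qed.

Lemma centered_left N i : (i < N)%N -> centered N (N - i.+1) = - half i.
Proof. by move=> iN; rewrite /centered natrB // -natr1; lra. Qed.

Lemma centered_rev N i : (i < N + N)%N -> centered N (N + N - i.+1) = - centered N i.
Proof. by move=> iN; rewrite /centered natrB // -natr1 natrD; lra. Qed.

Lemma centered_neq0 N i : centered N i != 0.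
Proof.
case: (ltnP i N) => iN; last by rewrite -(subnKC iN) centered_right gt_eqF ?half_gt0.
have -> : i = (N - (N - i.+1).+1)%N by lia.
by rewrite centered_left ?oppr_eq0 ?gt_eqF ?half_gt0 //; lia.
Qed.

Lemma centered_sub N i j : (i <= j)%N -> centered N j - centered N i = (j - i)%:R.
Proof. by move=> ij; rewrite /centered natrB //; lra. Qed.

Lemma invX_opp k (x : R) : (- x) ^- k = (-1) ^+ k * x ^- k.
Proof. by rewrite (exprNn x) invfM -exprVn invrN invr1. Qed.

Lemma big_centered (f : nat -> R) N :
  \sum_(i < N + N) f i = \sum_(i < N) f (N - i.+1)%N + \sum_(i < N) f (N + i)%N.
Proof. by rewrite big_split_ord /= (reindex_inj rev_ord_inj). Qed.

(** The distances from position [j] down to the earlier points are exactly [1, ..., j], hence the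
    inner cut at [j]. *)
Definition centered_zeta N k r : R :=
  \sum_(j < N + N) centered N j ^- k * zeta_part r j.

Lemma sum_centered N k :
  \sum_(j < N + N) centered N j ^- k = (1 + (-1) ^+ k) * ttilde_part k N.
Proof.
rewrite (big_centered (fun j => centered N j ^- k)) mulrDl mul1r addrC.
congr (_ + _); first by apply: eq_bigr => i _; rewrite centered_right.
by rewrite mulr_sumr; apply: eq_bigr => i _; rewrite centered_left // invX_opp.
Qed.

(* The symmetric truncation makes the conditionally convergent case [k = 1]
   harmless: the bilateral sum vanishes identically for odd [k]. *)
Lemma sum_centered_cvg k : (0 < k)%N ->
  (fun N => \sum_(j < N + N) centered N j ^- k) @ \oo -->
    (1 + (-1) ^+ k) * ttilde R k.
Proof.
move=> k0.
have -> : (fun N => \sum_(j < N + N) centered N j ^- k) =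
          (fun N => (1 + (-1) ^+ k) * ttilde_part k N).
  by apply/funext => N; exact: sum_centered.
case: k k0 => [//|[_|k _]]; last by apply: cvgMl_tmp; exact: ttilde_part_cvg.
(* For [k = 1] the factor 0 also cancels the junk value [ttilde R 1] in the limit. *)
rewrite expr1 subrr mul0r.
have -> : (fun N => 0 * ttilde_part 1 N) = (fun=> 0) by apply/funext => N; rewrite mul0r.
exact: cvg_cst.
Qed.

(** The paired numbers [a], [b] add up to [N], so [1/(ab) = (1/a + 1/b)/N], and reflection makes the
    two resulting sums equal. *)
Lemma sum_inv_half_pair N : (0 < N)%N ->
  \sum_(i < N) (half i)^-1 * (half (N - i.+1))^-1 =
  2 * ((\sum_(i < N) (half i)^-1) / N%:R).
Proof.
move=> N0.
have -> : 2 * ((\sum_(i < N) (half i)^-1) / N%:R) =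
  (\sum_(i < N) (half i)^-1 + \sum_(i < N) (half (N - i.+1))^-1) / N%:R.
  rewrite [X in _ + X](reindex_inj rev_ord_inj) /=.
  have -> : \sum_(j < N) (half (N - (N - j.+1).+1))^-1 = \sum_(i < N) (half i)^-1.
    by apply: eq_bigr => i _; congr (half _)^-1; have := ltn_ord i; lia.
  by rewrite mulrA mulr_natl.
rewrite -big_split mulr_suml; apply: eq_bigr => i _ /=.
have -> : N%:R = half i + half (N - i.+1).
  by rewrite natrB // -(natr1 i); lra.
have := half_gt0 i; have := half_gt0 (N - i.+1).
set a := half i; set b := half (N - i.+1) => b0 a0.
by field; rewrite !gt_eqF //; exact: addr_gt0.
Qed.

(** The tail at [j] is at most [1/(j + 1/2)], while the other factor is large only near [j = N].
    Each half of the window is dominated by [2^k] times the sum of [sum_inv_half_pair]. *)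
Lemma centered_tail_bound N k r : (0 < N)%N -> (0 < k)%N -> (1 < r)%N ->
  `|\sum_(j < N + N) centered N j ^- k * (zeta R r - zeta_part r j)| <=
  2 ^+ k * 4 * ((\sum_(i < N) (half i)^-1) / N%:R).
Proof.
move=> N0 k0 r1.
(* Since [2 * half i >= 1], its [k]-th power is at least itself; this is the origin of [2^k]. *)
have inv_bound i : half i ^- k <= 2 ^+ k * (half i)^-1.
  have h1 : 1 <= 2 * half i by have := ler0n R i; lra.
  have -> : half i ^- k = 2 ^+ k * (2 * half i) ^- k.
    by rewrite exprMn invfM mulrA divff ?mul1r // gt_eqF ?exprn_gt0.
  have h2 : 0 < 2 * half i by lra.
  rewrite ler_pM2l ?exprn_gt0 // lef_pV2 ?posrE ?exprn_gt0 ?half_gt0 //.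
  apply: (@le_trans _ _ (2 * half i)); first by have := half_gt0 i; lra.
  by rewrite -{1}[2 * _]expr1; apply: ler_weXn2l.
apply: le_trans (ler_norm_sum _ _ _) _.
apply: (@le_trans _ _ (\sum_(j < N + N) `|centered N j ^- k| * (half j)^-1)).
  apply: ler_sum => j _; rewrite normrM ler_wpM2l //.
  by rewrite ger0_norm ?zeta_tail_ge0 // zeta_tail_le.
rewrite (big_centered (fun j => `|centered N j ^- k| * (half j)^-1)).
have -> : 2 ^+ k * 4 * ((\sum_(i < N) (half i)^-1) / N%:R) =
    2 ^+ k * (2 * ((\sum_(i < N) (half i)^-1) / N%:R))
    + 2 ^+ k * (2 * ((\sum_(i < N) (half i)^-1) / N%:R)) by ring.
rewrite -(sum_inv_half_pair _ N0) mulr_sumr.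
apply: lerD; apply: ler_sum => i _.
  rewrite centered_left // normfV normrX normrN (gtr0_norm (half_gt0 i)) mulrA.
  by rewrite ler_pM2r ?invr_gt0 ?half_gt0.
(* On the positive half the tail index [N + i] exceeds [N - (i+1)], so the tail is below the one
   paired with [half i] on the negative half. *)
rewrite centered_right (ger0_norm (half_exp_ge0 _ _)) mulrA.
apply: ler_pM; rewrite ?half_exp_ge0 ?invr_ge0 ?(ltW (half_gt0 _)) //.
rewrite lef_pV2 ?posrE ?half_gt0 // lerD2r ler_nat; have := ltn_ord i; lia.
Qed.

Lemma centered_zeta_cvg k r : (0 < k)%N -> (1 < r)%N ->
  (fun N => centered_zeta N k r) @ \oo --> (1 + (-1) ^+ k) * ttilde R k * zeta R r.
Proof.
move=> k0 r1.
have -> : (fun N => centered_zeta N k r) = (fun N =>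
    (\sum_(j < N + N) centered N j ^- k) * zeta R r
    - \sum_(j < N + N) centered N j ^- k * (zeta R r - zeta_part r j)).
  apply/funext => N; rewrite mulr_suml -sumrB; apply: eq_bigr => j _; ring.
rewrite -[X in _ --> X]subr0; apply: cvgB.
  by apply: cvgMr_tmp; exact: sum_centered_cvg.
apply: norm_cvg0.
apply: (@squeeze_cvgr _ _ _ _ (fun=> 0)
  (fun N => 2 ^+ k * 4 * ((\sum_(i < N) (half i)^-1) / N%:R))).
- exists 1%N => //= N /= N0; rewrite normr_ge0 /=; exact: centered_tail_bound.
- exact: cvg_cst.
- by rewrite -[X in _ --> X](mulr0 (2 ^+ k * 4)); apply: cvgMl_tmp; exact: inv_half_mean_cvg0.
Qed.

(** * The double sum over the window, evaluated in two ways *)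

Definition centered_Tsum N p q : R :=
  \sum_(j < N + N) \sum_(i < j) centered N i ^- p * centered N j ^- q.

Lemma centered_Tsum_signs N p q : centered_Tsum N p q =
  Tsum_part p q N + (-1) ^+ (p + q) * Tsum_part q p N
  + (-1) ^+ p * ttilde_part p N * ttilde_part q N.
Proof.
rewrite /centered_Tsum big_split_ord /=.
(* Both numbers negative: negation reverses their order, which exchanges [p] and [q]. *)
have -> : \sum_(j < N) \sum_(i < j) centered N i ^- p * centered N j ^- q =
          (-1) ^+ (p + q) * Tsum_part q p N.
  rewrite (sum_pairs_rev _ _ (fun i j => centered N i ^- p * centered N j ^- q)).
  rewrite mulr_sumr; apply: eq_bigr => j _; rewrite mulr_sumr; apply: eq_bigr => i _.
  rewrite !centered_left // ?(ltn_trans (ltn_ord i)) // !invX_opp exprD; ring.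
have left : \sum_(i < N) centered N i ^- p = (-1) ^+ p * ttilde_part p N.
  rewrite (reindex_inj rev_ord_inj) mulr_sumr.
  by apply: eq_bigr => i _; rewrite centered_left // invX_opp.
(* Larger number positive: the smaller one is any of the [N] negatives or a positive below it. *)
have -> : \sum_(v < N) \sum_(i < N + v) centered N i ^- p * centered N (N + v) ^- q =
    Tsum_part p q N + (-1) ^+ p * ttilde_part p N * ttilde_part q N.
  rewrite mulr_sumr -big_split /=; apply: eq_bigr => v _.
  rewrite big_split_ord /= addrC -[X in _ + X]mulr_suml left centered_right.
  by congr (_ + _); apply: eq_bigr => u _; rewrite centered_right.
ring.
Qed.

Lemma zeta_part_diff r j : \sum_(i < j) (j - i)%:R ^- r = zeta_part r j.
Proof.
rewrite (reindex_inj rev_ord_inj); apply: eq_bigr => i _ /=.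
by rewrite subKn.
Qed.

Lemma centered_zeta_right N k r : centered_zeta N k r =
  \sum_(j < N + N) \sum_(i < j) centered N j ^- k * (j - i)%:R ^- r.
Proof. by apply: eq_bigr => j _; rewrite -mulr_sumr zeta_part_diff. Qed.

(** Negating the window exchanges the two members of a pair and keeps their distance, so both halves
    of the partial fractions reduce to [centered_zeta]. *)
Lemma centered_zeta_left N k r : (-1) ^+ k * centered_zeta N k r =
  \sum_(j < N + N) \sum_(i < j) centered N i ^- k * (j - i)%:R ^- r.
Proof.
rewrite (sum_pairs_rev _ _ (fun i j => centered N i ^- k * (j - i)%:R ^- r)).
rewrite mulr_sumr; apply: eq_bigr => j _.
rewrite -zeta_part_diff !mulr_sumr; apply: eq_bigr => i _.
rewrite centered_rev // invX_opp mulrA; congr (_ * _%:R ^- _).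
have := ltn_ord i; have := ltn_ord j; lia.
Qed.

Lemma centered_Tsum_fractions N p q : (0 < p + q)%N -> centered_Tsum N p q =
  \sum_(k < p) (-1) ^+ p * 'C((q + k).-1, k)%:R * centered_zeta N (p - k) (q + k)
  + (-1) ^+ p * \sum_(l < q) 'C((p + l).-1, l)%:R * centered_zeta N (q - l) (p + l).
Proof.
move=> pq0.
have E (j : 'I_(N + N)) (i : 'I_j) : centered N i ^- p * centered N j ^- q =
  \sum_(k < p) (-1) ^+ k * 'C((q + k).-1, k)%:R *
     (centered N i ^- (p - k) * (j - i)%:R ^- (q + k))
  + (-1) ^+ p *
     \sum_(l < q) 'C((p + l).-1, l)%:R *
        (centered N j ^- (q - l) * (j - i)%:R ^- (p + l)).
  have ji0 : (j - i)%:R != 0 :> R by rewrite pnatr_eq0 -lt0n subn_gt0.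
  rewrite -!exprVn (@partial_fractions _ _ _ (j - i)%:R^-1) //.
    by congr (_ + _ * _); apply: eq_bigr => k _; rewrite !exprVn !mulrA.
  rewrite -(centered_sub N) ?(ltnW (ltn_ord i)) //.
  field; rewrite !centered_neq0 centered_sub ?(ltnW (ltn_ord i)) //.
rewrite /centered_Tsum; under eq_bigr => j _ do under eq_bigr => i _ do rewrite E.
under eq_bigr => j _ do rewrite big_split /=.
rewrite big_split /=; congr (_ + _).
  under eq_bigr => j _ do rewrite exchange_big /=.
  rewrite exchange_big; apply: eq_bigr => k _ /=.
  (* The sign [(-1)^k] of the partial fractions and [(-1)^(p-k)] of the reflection combine to one
     independent of [k]. *)
  have -> : (-1) ^+ p = (-1) ^+ k * (-1) ^+ (p - k) :> R.
    by rewrite -exprD subnKC // ltnW.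
  rewrite [X in _ = X * _]mulrAC -[RHS]mulrA centered_zeta_left.
  rewrite mulr_sumr; apply: eq_bigr => j _; by rewrite mulr_sumr.
under eq_bigr => j _ do rewrite -mulr_sumr exchange_big /=.
rewrite -mulr_sumr exchange_big; congr (_ * _); apply: eq_bigr => l _ /=.
rewrite centered_zeta_right mulr_sumr; apply: eq_bigr => j _; by rewrite mulr_sumr.
Qed.

(** * Passage to the limit *)

Lemma sum_cvg n (f : 'I_n -> nat -> R) (l : 'I_n -> R) :
  (forall i, f i @ \oo --> l i) ->
  (fun N => \sum_(i < n) f i N) @ \oo --> \sum_(i < n) l i.
Proof. by move=> fl; apply: cvg_big => [|i _]; [exact: add_continuous|exact: fl]. Qed.

Lemma ttilde_mul p q : (1 < p)%N -> (1 < q)%N ->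
  ttilde R p * ttilde R q = Tsum R p q + Tsum R q p + ttilde R (p + q).
Proof.
move=> p1 q1.
apply: (@cvg_unique _ (@Rhausdorff R)
  (nbhs ((fun N => ttilde_part p N * ttilde_part q N) @ \oo))).
  by apply: cvgM; exact: ttilde_part_cvg.
have -> : (fun N => ttilde_part p N * ttilde_part q N) =
    (fun N => Tsum_part p q N + Tsum_part q p N + ttilde_part (p + q) N).
  by apply/funext => N; exact: ttilde_part_mul.
apply: cvgD; first by apply: cvgD; exact: Tsum_part_cvg.
by apply: ttilde_part_cvg; lia.
Qed.

(** Both evaluations of [centered_Tsum] converge: the index ranges keep [p - k] and [q - l] positive
    and every zeta argument above 1. *)
Lemma Tsum_reflection p q : (1 < p)%N -> (1 < q)%N ->
  Tsum R p q + (-1) ^+ (p + q) * Tsum R q p + (-1) ^+ p * ttilde R p * ttilde R q =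
  \sum_(k < p) (-1) ^+ p * 'C((q + k).-1, k)%:R *
    ((1 + (-1) ^+ (p - k)) * ttilde R (p - k) * zeta R (q + k))
  + (-1) ^+ p * \sum_(l < q) 'C((p + l).-1, l)%:R *
    ((1 + (-1) ^+ (q - l)) * ttilde R (q - l) * zeta R (p + l)).
Proof.
move=> p1 q1.
apply: (@cvg_unique _ (@Rhausdorff R) (nbhs ((fun N => centered_Tsum N p q) @ \oo))).
  have -> : (fun N => centered_Tsum N p q) = (fun N =>
      Tsum_part p q N + (-1) ^+ (p + q) * Tsum_part q p N
      + (-1) ^+ p * ttilde_part p N * ttilde_part q N).
    by apply/funext => N; exact: centered_Tsum_signs.
  apply: cvgD; first apply: cvgD.
  - exact: Tsum_part_cvg.
  - by apply: cvgMl_tmp; exact: Tsum_part_cvg.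
  - apply: cvgM; last exact: ttilde_part_cvg.
    by apply: cvgMl_tmp; exact: ttilde_part_cvg.
have -> : (fun N => centered_Tsum N p q) = (fun N =>
    \sum_(k < p) (-1) ^+ p * 'C((q + k).-1, k)%:R * centered_zeta N (p - k) (q + k)
    + (-1) ^+ p * \sum_(l < q) 'C((p + l).-1, l)%:R * centered_zeta N (q - l) (p + l)).
  by apply/funext => N; apply: centered_Tsum_fractions; lia.
apply: cvgD; last apply: cvgMl_tmp.
  apply: sum_cvg => k; apply: cvgMl_tmp; apply: centered_zeta_cvg.
    by rewrite subn_gt0.
  by lia.
apply: sum_cvg => l; apply: cvgMl_tmp; apply: centered_zeta_cvg.
  by rewrite subn_gt0.
by lia.
Qed.

End TruncatedSums.

(** * Reindexing into the stated formula *)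

(** This collapses the sum over [k1] once [k2] is fixed in [2 * k1 + k2 = q + 1]. *)
Lemma sum_double_eq (V : nmodType) n m (F : nat -> V) : (0 < m)%N -> (m <= n)%N ->
  \sum_(1 <= k < n) (if (2 * k == m)%N then F k else 0) =
  if odd m then 0 else F m./2.
Proof.
move=> m0 mn; rewrite -big_mkcond /=.
case: ifP => om.
  by rewrite big1_seq // => k /andP[/eqP E _]; move: om; rewrite -E mul2n odd_double.
have E k : (2 * k == m)%N = (k == m./2)%N.
  by have := odd_double_half m; rewrite om add0n -mul2n; lia.
under eq_bigl do rewrite E.
rewrite big_nat1_eq; case: ifP => //.
by have := odd_double_half m; rewrite om add0n -mul2n; lia.
Qed.

Theorem theorem2p4 (R : realType) (p q : nat) (hp : (1 < p)%N) (hq : (1 < q)%N) :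
  (1 - (-1) ^+ (p + q)) * Tsum R p q =
    (-1) ^+ (p + q) * ttilde R (p + q)
    - (-1) ^+ p * (1 + (-1) ^+ q) * ttilde R p * ttilde R q
    - (-1) ^+ p *
      \sum_(0 <= k < p)
        ((-1) ^+ k - 1) * 'C(p + q - k - 2, q - 1)%:R *
        ttilde R (k + 1) * zeta R (p + q - k - 1)
    + 2 * (-1) ^+ p *
      \sum_(1 <= k1 < q.+2) \sum_(1 <= k2 < q.+2 | (2 * k1 + k2 == q + 1)%N)
        'C(k2 + p - 2, p - 1)%:R * ttilde R (2 * k1) * zeta R (k2 + p - 1).
Proof.
have refl := Tsum_reflection R _ _ hp hq.
have mulE := ttilde_mul R _ _ hp hq.
(* Substituting [k -> p-1-k] flips the parity, turning [1 + (-1)^(p-k)] into minus the stated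
   factor. *)
have sum1 : \sum_(k < p) (-1) ^+ p * 'C((q + k).-1, k)%:R *
    ((1 + (-1) ^+ (p - k)) * ttilde R (p - k) * zeta R (q + k)) =
  - (-1) ^+ p * \sum_(0 <= k < p) ((-1) ^+ k - 1) * 'C(p + q - k - 2, q - 1)%:R *
        ttilde R (k + 1) * zeta R (p + q - k - 1).
  rewrite big_mkord [in RHS](reindex_inj rev_ord_inj) /= mulr_sumr.
  apply: eq_bigr => k _; have kp := ltn_ord k.
  have -> : (p + q - (p - k.+1) - 2 = (q + k).-1)%N by lia.
  have -> : (p + q - (p - k.+1) - 1 = q + k)%N by lia.
  have -> : (p - k.+1 + 1 = p - k)%N by lia.
  have -> : (-1) ^+ (p - k) = - (-1) ^+ (p - k.+1) :> R.
    by have -> : (p - k = (p - k.+1).+1)%N; [lia|rewrite exprS mulN1r].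
  have -> : 'C((q + k).-1, k) = 'C((q + k).-1, q - 1).
    by rewrite -bin_sub; [congr ('C(_, _)); lia|lia].
  ring.
have sum2 : \sum_(l < q) 'C((p + l).-1, l)%:R *
    ((1 + (-1) ^+ (q - l)) * ttilde R (q - l) * zeta R (p + l)) =
  2 * \sum_(1 <= k1 < q.+2) \sum_(1 <= k2 < q.+2 | (2 * k1 + k2 == q + 1)%N)
        'C(k2 + p - 2, p - 1)%:R * ttilde R (2 * k1) * zeta R (k2 + p - 1).
  under [X in 2 * X]eq_bigr => k1 _ do rewrite big_mkcond /=.
  (* With [k2 = l + 1], the last index [k2 = q + 1] would force [k1 = 0] and contributes nothing. *)
  rewrite exchange_big /= big_add1 /= big_nat_recr //= [X in _ + X]big1_seq; last first.
    move=> k1; rewrite mem_index_iota => /andP[_ /andP[k1_gt0 _]].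
    by case: eqP => //; lia.
  rewrite addr0 big_mkord mulr_sumr; apply: eq_bigr => l _; have lq := ltn_ord l.
  under eq_bigr => k1 _.
    have -> : (2 * k1 + l.+1 == q + 1)%N = (2 * k1 == q - l)%N by lia.
    over.
  rewrite (@sum_double_eq _ _ _ (fun k1 => 'C(l.+1 + p - 2, p - 1)%:R
    * ttilde R (2 * k1) * zeta R (l.+1 + p - 1))); [|lia|lia].
  have -> : (l.+1 + p - 2 = (p + l).-1)%N by lia.
  have -> : (l.+1 + p - 1 = p + l)%N by lia.
  have -> : 'C((p + l).-1, l) = 'C((p + l).-1, p - 1).
    by rewrite -bin_sub; [congr ('C(_, _)); lia|lia].
  rewrite -signr_odd; case: ifP => oql /=; first by rewrite expr1; ring.
  rewrite expr0; have -> : (2 * (q - l)./2 = q - l)%N.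
    by have := odd_double_half (q - l); rewrite oql add0n -mul2n.
  ring.
have T'E : Tsum R q p = ttilde R p * ttilde R q - Tsum R p q - ttilde R (p + q).
  by rewrite mulE; ring.
move: refl; rewrite sum1 sum2 T'E.
set S1 := \sum_(0 <= k < p) _; set S2 := \sum_(1 <= k1 < q.+2) _ => refl.
have : Tsum R p q = - ((-1) ^+ (p + q) *
     (ttilde R p * ttilde R q - Tsum R p q - ttilde R (p + q))) -
    (-1) ^+ p * ttilde R p * ttilde R q + (- (-1) ^+ p * S1 + (-1) ^+ p * (2 * S2)).
  by rewrite -refl; ring.
(* Only the first [Tsum R p q] is replaced: the copy inside [E], with coefficient [(-1)^(p+q)],
   cancels the subtracted one. *)
move=> E; rewrite mulrBl mul1r {1}E !exprD; ring.
Qed.
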